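(* Let $G$ be a group and let $S$ be a non-empty family of $T$-sequences in $G$. Then $S$ is a $T_s$-set of sequences if and only if the group topology $\inf_{\mathbf{u}\in S}\tau_{\mathbf{u}}$ is Hausdorff. In such a case, $\tau_S=\inf_{\mathbf{u}\in S}\tau_{\mathbf{u}}$.
   Context: Let $e_G$ be the unit of a group $G$. A sequence $\mathbf{u}=\{u_n\}$ in $G$ is a $T$-sequence if there is a Hausdorff group topology on $G$ in which $u_n\to e_G$; then $\tau_{\mathbf{u}}$ denotes the finest Hausdorff group topology on $G$ in which $u_n\to e_G$. A set $S$ of sequences in $G$ is a $T_s$-set of sequences if there is a Hausdorff group topology on $G$ in which all sequences of $S$ converge to $e_G$; then $\tau_S$ denotes the finest Hausdorff group topology on $G$ with this property. $\inf_{\mathbf{u}\in S}\tau_{\mathbf{u}}$ denotes the infimum of the topologies $\tau_{\mathbf{u}}$ in the lattice of all (not necessarily Hausdorff) group topologies on $G$. *)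

(* Defs.v *)
From HB Require Import structures.
From mathcomp Require Import all_boot.
From mathcomp Require Import all_classical topology.

Set Implicit Arguments.
Unset Strict Implicit.
Unset Printing Implicit Defensive.

Local Open Scope classical_set_scope.

(* Several topologies on one group are compared here, so a topology on [T] is a
   first-class object; [topspace tau] is the corresponding [topologicalType]. *)
Record topology (T : Type) := Topology {
  opens :> set (set T);
  opens_setT : opens setT;
  opens_setI : forall A B, opens A -> opens B -> opens (A `&` B);
  opens_bigcup : forall (I : Type) (f : I -> set T),
    (forall i, opens (f i)) -> opens (\bigcup_i f i) }.

Lemma topology_ext (T : Type) (s t : topology T) : opens s = opens t -> s = t.
Proof.
case: s t => [U a b c] [V a' b' c'] /= UV; subst V.
by rewrite (Prop_irrelevance a a') (Prop_irrelevance b b') (Prop_irrelevance c c').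
Qed.

HB.instance Definition _ (T : Type) := gen_eqMixin (topology T).
HB.instance Definition _ (T : Type) := gen_choiceMixin (topology T).

Definition topspace (G : groupType) (tau : topology G) : Type := G.

HB.instance Definition _ (G : groupType) (tau : topology G) :=
  Group.copy (topspace tau) G.
HB.instance Definition _ (G : groupType) (tau : topology G) :=
  @isOpenTopological.Build (topspace tau) (opens tau)
    (opens_setT tau) (@opens_setI _ tau) (@opens_bigcup _ tau).

Definition indiscrete_opens (T : Type) : set (set T) :=
  [set A | forall x y, A x -> A y].

Lemma indiscrete_setI (T : Type) (A B : set T) :
  indiscrete_opens A -> indiscrete_opens B -> indiscrete_opens (A `&` B).
Proof. by move=> oA oB x y [Ax Bx]; split; [exact: oA Ax | exact: oB Bx]. Qed.

Lemma indiscrete_bigcup (T I : Type) (f : I -> set T) :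
  (forall i, indiscrete_opens (f i)) -> indiscrete_opens (\bigcup_i f i).
Proof. by move=> of_ x y [i _ fx]; exists i => //; exact: of_ fx. Qed.

Definition indiscrete (T : Type) : topology T :=
  @Topology T (@indiscrete_opens T) (fun _ _ _ => I)
    (@indiscrete_setI T) (@indiscrete_bigcup T).

Definition coarser (T : Type) (s t : topology T) : Prop := opens s `<=` opens t.

Definition is_finest (T : Type) (P : set (topology T)) (t : topology T) : Prop :=
  P t /\ forall s, P s -> coarser s t.

(* [indiscrete T] is a junk value, returned when [P] has no finest element. *)
Definition finest (T : Type) (P : set (topology T)) : topology T :=
  xget (indiscrete T) [set t | is_finest P t].

Section group_topologies.
Variable G : groupType.
Implicit Types (tau : topology G) (u : nat -> G) (S : set (nat -> G)).

Definition group_topology tau : Prop :=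
  continuous (fun xy : topspace tau * topspace tau =>
                (xy.1 * xy.2)%g : topspace tau) /\
  continuous (fun x : topspace tau => x^-1%g : topspace tau).

Definition hausdorff tau : Prop := hausdorff_space (topspace tau).

Definition cvg_to_unit tau u : Prop :=
  (u : nat -> topspace tau) @ \oo --> (1%g : topspace tau).

Definition T_sequence u : Prop :=
  exists tau, [/\ group_topology tau, hausdorff tau & cvg_to_unit tau u].

Definition tau_seq u : topology G :=
  finest [set tau | [/\ group_topology tau, hausdorff tau & cvg_to_unit tau u]].

Definition Ts_set S : Prop :=
  exists tau, [/\ group_topology tau, hausdorff tau &
                  forall u, S u -> cvg_to_unit tau u].

Definition tau_set S : topology G :=
  finest [set tau | [/\ group_topology tau, hausdorff tau &
                        forall u, S u -> cvg_to_unit tau u]].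

(* Greatest lower bound, for inclusion, among all group topologies. *)
Definition inf_group_topology (F : set (topology G)) : topology G :=
  finest [set tau | group_topology tau /\ forall s, F s -> coarser tau s].

End group_topologies.

(* Joins provide the finest elements, so [tau_seq], [tau_set] and
   [inf_group_topology] never take the junk value. *)

Lemma finestP (T : Type) (P : set (topology T)) t :
  is_finest P t -> is_finest P (finest P).
Proof. by move=> Pt; rewrite /finest; case: xgetP => // /(_ t) /(_ Pt). Qed.

Lemma finest_unique (T : Type) (P : set (topology T)) t :
  is_finest P t -> finest P = t.
Proof.
move=> Pt; have [Pf fP] := finestP Pt; have [Pt0 tP] := Pt.
by apply: topology_ext; apply/seteqP; split; [exact: tP | exact: fP].
Qed.

Section join.
Variables (T : Type) (P : set (topology T)).

Definition join_opens : set (set T) :=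
  [set A | forall t : topology T, (forall s, P s -> coarser s t) -> opens t A].

Lemma join_setT : join_opens setT.
Proof. by move=> t _; exact: opens_setT. Qed.

Lemma join_setI A B : join_opens A -> join_opens B -> join_opens (A `&` B).
Proof. by move=> oA oB t Pt; apply: opens_setI; [exact: oA | exact: oB]. Qed.

Lemma join_bigcup (I : Type) (f : I -> set T) :
  (forall i, join_opens (f i)) -> join_opens (\bigcup_i f i).
Proof. by move=> of_ t Pt; apply: opens_bigcup => i; exact: of_. Qed.

Definition join := Topology join_setT join_setI join_bigcup.

Lemma join_ub s : P s -> coarser s join.
Proof. by move=> Ps A sA t Pt; exact: Pt sA. Qed.

Lemma join_lub t : (forall s, P s -> coarser s t) -> coarser join t.
Proof. by move=> Pt A jA; exact: jA Pt. Qed.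

End join.

Section coinduced.
Variables (X : topologicalType) (T : Type) (f : X -> T).

Definition coinduced_opens : set (set T) := [set A | open (f @^-1` A)].

Lemma coinduced_setT : coinduced_opens setT.
Proof. exact: openT. Qed.

Lemma coinduced_setI A B :
  coinduced_opens A -> coinduced_opens B -> coinduced_opens (A `&` B).
Proof. by move=> oA oB; exact: openI oA oB. Qed.

Lemma coinduced_bigcup (I : Type) (g : I -> set T) :
  (forall i, coinduced_opens (g i)) -> coinduced_opens (\bigcup_i g i).
Proof.
move=> og; rewrite /coinduced_opens/= preimage_bigcup.
by apply: bigcup_open => i _; exact: og.
Qed.

Definition coinduced := Topology coinduced_setT coinduced_setI coinduced_bigcup.

End coinduced.

Section limit.
Context (T : Type) (F : set_system T) {FF : Filter F} (x : T).

Definition limit_opens : set (set T) := [set A | A x -> F A].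

Lemma limit_setT : limit_opens setT.
Proof. by move=> _; exact: filterT. Qed.

Lemma limit_setI A B : limit_opens A -> limit_opens B -> limit_opens (A `&` B).
Proof. by move=> oA oB [Ax Bx]; apply: filterI; [exact: oA | exact: oB]. Qed.

Lemma limit_bigcup (I : Type) (f : I -> set T) :
  (forall i, limit_opens (f i)) -> limit_opens (\bigcup_i f i).
Proof. by move=> of_ [i _ /of_]; apply: filterS => y fy; exists i. Qed.

Definition limit := Topology limit_setT limit_setI limit_bigcup.

End limit.

Section existence.
Variable G : groupType.
Implicit Types (s t : topology G) (P : set (topology G)).

Lemma continuous_coarser s t :
  coarser s t -> continuous (id : topspace t -> topspace s).
Proof. by move=> st; apply/continuousP => A; exact: st. Qed.

Lemma group_topology_join P :
  (forall t, P t -> group_topology t) -> group_topology (join P).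
Proof.
move=> Pg; split; apply/continuousP => A jA.
  pose f (xy : topspace (join P) * topspace (join P)) : G := (xy.1 * xy.2)%g.
  apply: (jA (coinduced f)) => s Ps B sB.
  have /continuousP/(_ B sB) := (Pg s Ps).1.
  have sj := continuous_coarser (join_ub Ps).
  have /continuousP : continuous
    (fun xy : topspace (join P) * topspace (join P) =>
       (xy.1, xy.2) : topspace s * topspace s).
    move=> [x y] A' [[B' C'] /= [xB yC] BCA]; exists (B', C') => /=.
      by split; exact: sj.
    by move=> [a b] [/= aB bC]; exact: BCA.
  by move=> /[apply].
apply: (jA (coinduced (fun x : topspace (join P) => x^-1%g : G))) => s Ps B sB.
have /continuousP/(_ B sB) := (Pg s Ps).2.
exact: (join_ub Ps).
Qed.

Lemma hausdorff_coarser s t : coarser s t -> hausdorff s -> hausdorff t.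
Proof.
move=> st hs p q pq; apply: hs => A B pA qB.
by apply: pq; exact: (continuous_coarser st).
Qed.

Lemma cvg_to_unit_limit t u :
  cvg_to_unit t u <-> coarser t (@limit G (u @ \oo) _ 1%g).
Proof.
split=> [ut A tA A1|tl A].
  by apply: ut; exact: (@open_nbhs_nbhs (topspace t)).
rewrite nbhsE => -[B [tB B1] BA].
by have := tl B tB B1; apply: filterS.
Qed.

Lemma tau_setP (S : set (nat -> G)) : Ts_set S ->
  is_finest [set t | [/\ group_topology t, hausdorff t &
                         forall u, S u -> cvg_to_unit t u]] (tau_set S).
Proof.
move=> [s Ps]; apply: (@finestP _ _ (join _)); split; last first.
  by move=> t; exact: join_ub.
split.
- by apply: group_topology_join => t [].
- by apply: (hausdorff_coarser (join_ub Ps)); case: Ps.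
- move=> u Su; apply/cvg_to_unit_limit/join_lub => t [_ _ /(_ _ Su)].
  by move/cvg_to_unit_limit.
Qed.

Lemma tau_seqP (u : nat -> G) : T_sequence u ->
  is_finest [set t | [/\ group_topology t, hausdorff t & cvg_to_unit t u]]
            (tau_seq u).
Proof.
move=> [s Ps]; apply: (@finestP _ _ (join _)); split; last first.
  by move=> t; exact: join_ub.
split.
- by apply: group_topology_join => t [].
- by apply: (hausdorff_coarser (join_ub Ps)); case: Ps.
- by apply/cvg_to_unit_limit/join_lub => t [_ _] /cvg_to_unit_limit.
Qed.

Lemma inf_group_topologyP (F : set (topology G)) :
  is_finest [set t | group_topology t /\ forall s, F s -> coarser t s]
            (inf_group_topology F).
Proof.
apply: (@finestP _ _ (join _)); split; last by move=> t; exact: join_ub.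
split; first by apply: group_topology_join => t [].
by move=> s Fs; apply: join_lub => t [_ tF]; exact: tF.
Qed.

End existence.

(* Main.v *)
(* A Hausdorff group topology makes every sequence of S converge to the unit
   exactly when it is coarser than every tau_u, i.e. than their infimum. *)
Require Import Defs.
From mathcomp Require Import all_boot.
From mathcomp Require Import all_classical topology.

Local Open Scope classical_set_scope.

(** By [cvg_to_unit_coarser_tau_seq], a topology witnessing [Ts_set S] is a lower bound of the
    [tau_seq u], so it lies below their infimum, which is then Hausdorff, being finer than a
    Hausdorff topology. Conversely, a Hausdorff infimum is itself a witness, and the finest one. *)

Lemma coarser_trans (T : Type) (s t r : topology T) :
  coarser s t -> coarser t r -> coarser s r.
Proof. exact: subset_trans. Qed.

Lemma coarser_anti (T : Type) (s t : topology T) :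
  coarser s t -> coarser t s -> s = t.
Proof. by move=> st ts; apply: topology_ext; apply/seteqP. Qed.

(** Convergence to the unit means being coarser than a fixed [limit] topology, so transitivity
    suffices. *)
Lemma cvg_to_unit_coarser (G : groupType) (s t : topology G) (u : nat -> G) :
  coarser s t -> cvg_to_unit t u -> cvg_to_unit s u.
Proof.
move=> st /cvg_to_unit_limit tu; apply/cvg_to_unit_limit.
exact: coarser_trans st tu.
Qed.

Lemma cvg_to_unit_coarser_tau_seq (G : groupType) (t : topology G)
    (u : nat -> G) :
  T_sequence u -> group_topology t -> hausdorff t ->
  cvg_to_unit t u <-> coarser t (tau_seq u).
Proof.
move=> /tau_seqP [[_ _ cvg_tau] max_tau] tG tH; split=> [tu|t_tau].
  (* Maximality of [tau_seq u] ranges over Hausdorff topologies only, hence [tH]. *)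
  by apply: max_tau; split.
exact: cvg_to_unit_coarser t_tau cvg_tau.
Qed.

Theorem theorem1p9 (G : groupType) (S : set (nat -> G))
  (S_nonempty : S !=set0) (S_T : forall u, S u -> T_sequence u) :
  (Ts_set S <-> hausdorff (inf_group_topology [set tau_seq u | u in S])) /\
  (Ts_set S -> tau_set S = inf_group_topology [set tau_seq u | u in S]).
Proof.
have [] := inf_group_topologyP [set tau_seq u | u in S].
set i := inf_group_topology _ => -[iG i_lb] i_max.
have le_i t : group_topology t -> hausdorff t ->
    (forall u, S u -> cvg_to_unit t u) -> coarser t i.
  move=> tG tH tS; apply: i_max; split=> // _ [u Su <-].
  by apply/cvg_to_unit_coarser_tau_seq; [exact: S_T| | |exact: tS].
have i_cvg u : hausdorff i -> S u -> cvg_to_unit i u.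
  move=> iH Su; apply/cvg_to_unit_coarser_tau_seq => //; first exact: S_T.
  by apply: i_lb; exists u.
have Ts_i : Ts_set S -> hausdorff i.
  by move=> [t [tG tH tS]]; apply: hausdorff_coarser (tH); exact: le_i.
split; first by split=> // iH; exists i; split=> // u; exact: i_cvg.
move=> TsS; have [[tG tH tS] t_max] := tau_setP TsS.
apply: coarser_anti; first exact: le_i.
(* Being Hausdorff, [i] competes in the family whose finest member is [tau_set S]. *)
by apply: t_max; split=> // [|u]; [exact: Ts_i | apply: i_cvg; exact: Ts_i].
Qed.
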